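(* Let $\beta=(B,(B_i)_{i\in I_\beta})$ be a coset incidence system, let $j\in I_\beta$, assume that the set $X_j=\{\sigma B_j\mid\sigma\in B\}$ is finite with more than one element, and let $\lambda:\mathcal{C}^j_\beta\to\{2,3,\ldots\}\cup\{\infty\}$ be a label function on the $j$-diagonal classes. Let $\mathcal{D}=\mathcal{D}(\beta,j,\lambda)$ be the associated $j$-diagonal Coxeter graph, $A=W(\mathcal{D})$, $\alpha=(A,(A_F)_{F\in X_j})$ the standard coset incidence system of $A$, and $\eta:B\to\operatorname{Aut}(A)$ the induced action. Then $\eta$ permutes the maximal parabolic subgroups $A_F$ of $\alpha$, and the induced action of $B$ on the type set $X_j$ is transitive. Let $F_L=B_j$ be the chosen base point of the unique orbit $L=X_j$. Then $\alpha$ is $(\beta,\eta)$-admissible if and only if $$\mathcal{O}(M)\cap\mathcal{O}(N)=\mathcal{O}(M\cap N)\qquad\text{for all }M,N\subseteq I_\beta,$$ where $\mathcal{O}(M)=B_{I_\beta\setminus M}\cdot F_L$. Moreover, if $B$ is flag-transitive on $\beta$, then $\alpha$ is $(\beta,\eta)$-admissible.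
   Context: Coset incidence systems. Given a group $B$ and a family $(B_i)_{i\in I_\beta}$ of subgroups (the maximal parabolic subgroups), the coset incidence system $\beta=(B,(B_i)_{i\in I_\beta})$ has as elements of type $i$ the left cosets $bB_i$; two cosets are incident if they intersect. $B$ acts by left multiplication. For $J\subseteq I_\beta$, $B_J=\bigcap_{i\in J}B_i$ and $B_\emptyset=B$. A flag is a set of pairwise incident elements (distinct incident elements have different types); $B$ is flag-transitive on $\beta$ if for every $J\subseteq I_\beta$ it is transitive on flags whose set of types is $J$; equivalently, $B_HB_J\cap B_KB_J=(B_H\cap B_K)B_J$ for all $H,J,K\subseteq I_\beta$. Diagonals. A $j$-diagonal is an unordered pair $\{F_1,F_2\}$ of distinct elements of $X_j$. Two $j$-diagonals are equivalent if some $b\in B$ maps one to the other (as unordered pairs). The equivalence class is $[F_1,F_2]$, and $\mathcal{C}^j_\beta$ is the set of all classes. Diagonal Coxeter graph. $\mathcal{D}(\beta,j,\lambda)$ has vertex set $X_j$; distinct $F_1,F_2$ are joined by an edge iff $\lambda([F_1,F_2])\neq 2$, and the edge is then labelled $\lambda([F_1,F_2])$. The Coxeter group $W(\mathcal{D})$ is generated by $a_F$ ($F\in X_j$) with defining relations $a_F^2=1$ and $(a_Fa_E)^{\lambda([F,E])}=1$ for $F\ne E$ with $\lambda([F,E])<\infty$. Set $A_F=\langle a_E\mid E\in X_j\setminus\{F\}\rangle$; the standard coset incidence system is $\alpha=(A,(A_F)_{F\in X_j})$. The action $\eta:B\to\operatorname{Aut}(A)$ is given by $\eta(b)(a_F)=a_{bF}$.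 Admissibility. Let $\alpha=(A,(A_i)_{i\in I_\alpha})$ and $\beta$ be coset incidence systems and $\eta:B\to\operatorname{Aut}(A)$ an action permuting the maximal parabolic subgroups of $\alpha$; it induces an action of $B$ on $I_\alpha$ (with $\eta(b)(A_i)=A_{b\cdot i}$). Let $\mathcal{K}$ be the set of orbits on $I_\alpha$ and for each $L\in\mathcal{K}$ choose a representative $F_L\in L$. For $M\subseteq I_\beta$ put $\mathcal{O}_L(M)=B_{I_\beta\setminus M}\cdot F_L$. Then $\alpha$ is $(\beta,\eta)$-admissible (with respect to the chosen representatives) when $\eta$ permutes the maximal parabolic subgroups and $\mathcal{O}_L(M)\cap\mathcal{O}_L(N)=\mathcal{O}_L(M\cap N)$ for all $L\in\mathcal{K}$ and all $M,N\subseteq I_\beta$. *)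

(* Defs.v *)
From HB Require Import structures.
From mathcomp Require Import all_boot.
From mathcomp Require Import mathcomp_extra boolp classical_sets functions.
From mathcomp Require Import cardinality.

Set Implicit Arguments.
Unset Strict Implicit.
Unset Printing Implicit Defensive.

Local Open Scope classical_set_scope.
Local Open Scope group_scope.


Definition subgroup (G : groupType) (H : set G) : Prop :=
  [/\ H 1, (forall x y, H x -> H y -> H (x * y)) & (forall x, H x -> H x^-1)].

Definition generated (G : groupType) (S : set G) : set G :=
  smallest (@subgroup G) S.

Lemma generated_subgroup (G : groupType) (S : set G) : subgroup (generated S).
Proof.
split=> [|x y Sx Sy|x Sx] H HP; have [[H1 HM HV] _] := HP => //.
- by apply: HM; [exact: Sx|exact: Sy].
- by apply: HV; exact: Sx.
Qed.

Record is_action (G : groupType) (T : Type) (act : G -> T -> T) : Prop := {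
  act1 : forall x, act 1 x = x;
  actM : forall g h x, act (g * h) x = act g (act h x) }.

Definition transitive_action (G : groupType) (T : Type) (act : G -> T -> T) :=
  forall x y, exists g, act g x = y.

Definition orbits (G : groupType) (T : Type) (act : G -> T -> T) :
    set (set T) :=
  [set L | exists x, L = [set act g x | g in setT]].

(* The product of Aut(A) is composition, (f * g)(x) = f (g x), so that a      *)
(* morphism to Aut(A) is a left action; this is the opposite of the           *)
(* convention of {perm T}.                                                    *)
Section Automorphisms.
Variable A : groupType.

Record autom := Autom {
  aut_fun :> A -> A;
  aut_morph : {morph aut_fun : x y / x * y};
  aut_bij : bijective aut_fun }.

Lemma autom_eq (f g : autom) : f =1 g -> f = g.
Proof.
case: f g => [f fM fB] [g gM gB] /= /funext fg; rewrite fg in fM fB *.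
by congr Autom; exact: Prop_irrelevance.
Qed.

Definition autom1 : autom :=
  @Autom id (fun x y => erefl) (Bijective (fun=> erefl) (fun=> erefl)).

Definition autom_mul (f g : autom) : autom.
Proof.
refine (@Autom (f \o g) _ (bij_comp (aut_bij f) (aut_bij g))).
by move=> x y /=; rewrite !aut_morph.
Defined.

Lemma autom_inv_subproof (f : autom) :
  exists g : autom, cancel f g /\ cancel g f.
Proof.
have [h fK hK] := aut_bij f.
have hM : {morph h : x y / x * y}.
  by move=> x y; apply: (can_inj fK); rewrite hK aut_morph !hK.
by exists (Autom hM (Bijective hK fK)).
Qed.

Definition autom_inv (f : autom) : autom := sval (cid (autom_inv_subproof f)).

HB.instance Definition _ := gen_eqMixin autom.
HB.instance Definition _ := gen_choiceMixin autom.

Fact autom_mulA : associative autom_mul.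
Proof. by move=> f g h; apply: autom_eq. Qed.
Fact autom_mul1 : left_id autom1 autom_mul.
Proof. by move=> f; apply: autom_eq. Qed.
Fact autom_1mul : right_id autom1 autom_mul.
Proof. by move=> f; apply: autom_eq. Qed.
Fact autom_mulV : left_inverse autom1 autom_inv autom_mul.
Proof.
move=> f; apply: autom_eq => x /=; rewrite /autom_inv.
by case: cid => g /= [fK _]; exact: fK.
Qed.
Fact autom_Vmul : right_inverse autom1 autom_inv autom_mul.
Proof.
move=> f; apply: autom_eq => x /=; rewrite /autom_inv.
by case: cid => g /= [_ gK]; exact: gK.
Qed.

HB.instance Definition _ := isGroup.Build autom
  autom_mulA autom_mul1 autom_1mul autom_mulV autom_Vmul.

End Automorphisms.

(* Groups given by generators and relators. The letter (x, true) stands for   *)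
(* the generator x and (x, false) for its inverse.                            *)
Section Presentations.
Variables (V : choiceType) (R : set (seq (V * bool))).

Inductive pres_eq : seq (V * bool) -> seq (V * bool) -> Prop :=
| pres_refl w : pres_eq w w
| pres_sym w w' : pres_eq w w' -> pres_eq w' w
| pres_trans w w' w'' : pres_eq w w' -> pres_eq w' w'' -> pres_eq w w''
| pres_cancel u x e v : pres_eq (u ++ [:: (x, e); (x, ~~ e)] ++ v) (u ++ v)
| pres_rel u r v : R r -> pres_eq (u ++ r ++ v) (u ++ v).

Definition pres_eqb : rel (seq (V * bool)) := fun w w' => `[< pres_eq w w' >].

Fact pres_eqb_equiv : equiv_class_of pres_eqb.
Proof.
split=> [w|w w'|w' w w'']; first exact/asboolP/pres_refl.
- by apply/asboolP/asboolP; exact: pres_sym.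
- by move=> /asboolP h /asboolP h'; apply/asboolP; exact: pres_trans h h'.
Qed.

Canonical pres_equiv := EquivRelPack pres_eqb_equiv.

Definition presented := {eq_quot pres_equiv}%qT.
HB.instance Definition _ := Choice.on presented.
HB.instance Definition _ := Quotient.on presented.

Definition pres_class (w : seq (V * bool)) : presented := (\pi w)%qT.

Lemma pres_classP w w' : pres_class w = pres_class w' <-> pres_eq w w'.
Proof.
split=> [/eqP|h]; rewrite /pres_class; first by rewrite piE => /asboolP.
by apply/eqP; rewrite piE; apply/asboolP.
Qed.

Lemma pres_reprK x : pres_class (repr x)%qT = x.
Proof. exact: reprK. Qed.

Lemma pres_ind (P : presented -> Prop) :
  (forall w, P (pres_class w)) -> forall x, P x.
Proof. by move=> h x; rewrite -(pres_reprK x). Qed.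

Lemma pres_eq_cat u u' v v' :
  pres_eq u u' -> pres_eq v v' -> pres_eq (u ++ v) (u' ++ v').
Proof.
move=> hu hv; apply: (@pres_trans _ (u' ++ v)).
  elim: hu => {u u'} [w|w w' _|w w' w'' _ h _ h'|a x e b|a r b Rr].
  - exact: pres_refl.
  - exact: pres_sym.
  - exact: pres_trans h h'.
  - by rewrite -!catA; exact: pres_cancel.
  - by rewrite -!catA; exact: pres_rel.
elim: hv => {v v'} [w|w w' _|w w' w'' _ h _ h'|a x e b|a r b Rr].
- exact: pres_refl.
- exact: pres_sym.
- exact: pres_trans h h'.
- by have := pres_cancel (u' ++ a) x e b; rewrite -!catA.
- by have := pres_rel (u' ++ a) b Rr; rewrite -!catA.
Qed.

Definition inv_word (w : seq (V * bool)) := rev [seq (l.1, ~~ l.2) | l <- w].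

Lemma inv_wordK : involutive inv_word.
Proof.
move=> w; rewrite /inv_word map_rev revK -map_comp -[RHS]map_id.
by apply: eq_map => -[x e] /=; rewrite negbK.
Qed.

Lemma pres_eq_inv_r w : pres_eq (w ++ inv_word w) [::].
Proof.
elim: w => [|[x e] w IHw]; first exact: pres_refl.
rewrite /inv_word /= rev_cons -cats1.
apply: pres_trans (pres_cancel [::] x e [::]).
have h := pres_eq_cat (pres_refl [:: (x, e)])
  (pres_eq_cat IHw (pres_refl [:: (x, ~~ e)])).
by rewrite -catA in h.
Qed.

Lemma pres_eq_inv_l w : pres_eq (inv_word w ++ w) [::].
Proof. by rewrite -{2}[w]inv_wordK; exact: pres_eq_inv_r. Qed.

Lemma pres_eq_inv w w' : pres_eq w w' -> pres_eq (inv_word w) (inv_word w').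
Proof.
move=> h; apply: (@pres_trans _ (inv_word w ++ (w' ++ inv_word w'))).
  rewrite -{1}[inv_word w]cats0; apply: pres_eq_cat; first exact: pres_refl.
  exact/pres_sym/pres_eq_inv_r.
rewrite catA -[X in pres_eq _ X]cat0s; apply: pres_eq_cat (pres_refl _).
apply: pres_trans (pres_eq_inv_l w).
by apply: pres_eq_cat; [exact: pres_refl|exact: pres_sym].
Qed.

Definition pres_one : presented := pres_class [::].
Definition pres_mul (x y : presented) : presented :=
  pres_class (repr x ++ repr y)%qT.
Definition pres_inv (x : presented) : presented :=
  pres_class (inv_word (repr x)%qT).

Lemma pres_mulE u v :
  pres_mul (pres_class u) (pres_class v) = pres_class (u ++ v).
Proof.
by apply/pres_classP/pres_eq_cat; apply/pres_classP; rewrite pres_reprK.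
Qed.

Lemma pres_invE u : pres_inv (pres_class u) = pres_class (inv_word u).
Proof. by apply/pres_classP/pres_eq_inv/pres_classP; rewrite pres_reprK. Qed.

Fact pres_mulA : associative pres_mul.
Proof.
elim/pres_ind=> u; elim/pres_ind=> v; elim/pres_ind=> w.
by rewrite !pres_mulE catA.
Qed.
Fact pres_mul1 : left_id pres_one pres_mul.
Proof. by elim/pres_ind=> u; rewrite pres_mulE. Qed.
Fact pres_1mul : right_id pres_one pres_mul.
Proof. by elim/pres_ind=> u; rewrite pres_mulE cats0. Qed.
Fact pres_mulV : left_inverse pres_one pres_inv pres_mul.
Proof.
elim/pres_ind=> u; rewrite pres_invE pres_mulE.
exact/pres_classP/pres_eq_inv_l.
Qed.
Fact pres_Vmul : right_inverse pres_one pres_inv pres_mul.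
Proof.
elim/pres_ind=> u; rewrite pres_invE pres_mulE.
exact/pres_classP/pres_eq_inv_r.
Qed.

HB.instance Definition _ := isGroup.Build presented
  pres_mulA pres_mul1 pres_1mul pres_mulV pres_Vmul.

Definition pres_gen (x : V) : presented := pres_class [:: (x, true)].

Section Lift.
Variables (G : groupType) (f : V -> G).

Fixpoint word_eval (w : seq (V * bool)) : G :=
  if w is (x, e) :: w' then (if e then f x else (f x)^-1) * word_eval w' else 1.

Lemma word_eval_cat u v : word_eval (u ++ v) = word_eval u * word_eval v.
Proof.
by elim: u => [|[x e] u IHu] /=; rewrite ?mul1g // IHu mulgA.
Qed.

Hypothesis fR : forall r, R r -> word_eval r = 1.

Lemma word_eval_pres_eq u v : pres_eq u v -> word_eval u = word_eval v.
Proof.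
elim=> {u v} [//|//|w w' w'' _ -> _ ->//|u x e v|u r v Rr].
  by rewrite !word_eval_cat; case: e; rewrite /= mulg1 ?mulgV ?mulVg mul1g.
by rewrite !word_eval_cat (fR Rr) mul1g.
Qed.

Definition pres_lift (x : presented) : G := word_eval (repr x)%qT.

Lemma pres_lift_class w : pres_lift (pres_class w) = word_eval w.
Proof. by apply/word_eval_pres_eq/pres_classP; rewrite pres_reprK. Qed.

Lemma pres_liftM : {morph pres_lift : x y / x * y}.
Proof.
elim/pres_ind=> u; elim/pres_ind=> v.
by rewrite [_ * _]pres_mulE !pres_lift_class word_eval_cat.
Qed.

Lemma pres_lift_gen x : pres_lift (pres_gen x) = f x.
Proof. by rewrite pres_lift_class /= mulg1. Qed.

End Lift.

Lemma pres_gen_rel r : R r -> word_eval pres_gen r = 1.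
Proof.
suff -> : word_eval pres_gen r = pres_class r.
  by move=> Rr; apply/pres_classP; have := pres_rel [::] [::] Rr; rewrite cats0.
elim: r => [//|[x e] r /= ->]; case: e; first by rewrite [LHS]pres_mulE.
by rewrite [_^-1]pres_invE [LHS]pres_mulE.
Qed.

Lemma pres_hom_eq (G : groupType) (f g : presented -> G) :
  {morph f : x y / x * y} -> {morph g : x y / x * y} ->
  (forall x, f (pres_gen x) = g (pres_gen x)) -> f =1 g.
Proof.
move=> fM gM fg.
have f1 : f 1 = 1 by apply: (mulgI (f 1)); rewrite -fM !mulg1.
have g1 : g 1 = 1 by apply: (mulgI (g 1)); rewrite -gM !mulg1.
elim/pres_ind; elim=> [|[x e] w IHw]; first by rewrite [f _]f1 [g _]g1.
have -> : pres_class ((x, e) :: w) = pres_class [:: (x, e)] * pres_class w.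
  by rewrite [RHS]pres_mulE.
rewrite fM gM IHw; congr (_ * _); case: e; first exact: fg.
have -> : pres_class [:: (x, false)] = (pres_gen x)^-1 by rewrite [RHS]pres_invE.
by apply: (mulgI (f (pres_gen x))); rewrite -fM mulgV f1 fg -gM mulgV g1.
Qed.

End Presentations.

(* None is the label oo. *)
Definition label := option {n : nat | (2 <= n)%N}.

Record coxeter_graph (V : Type) := CoxeterGraph {
  cg_edge : V -> V -> Prop;
  cg_label : forall x y, cg_edge x y -> label;
  cg_irr : forall x, ~ cg_edge x x;
  cg_sym : forall x y, cg_edge x y -> cg_edge y x;
  cg_label_sym : forall x y (e : cg_edge x y) (e' : cg_edge y x),
    cg_label e = cg_label e' }.

Section CoxeterGroups.
Variables (V : choiceType) (D : coxeter_graph V).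

Definition power_word (x y : V) (n : nat) : seq (V * bool) :=
  flatten (nseq n [:: (x, true); (y, true)]).

Inductive coxeter_relator : set (seq (V * bool)) :=
| cox_square x : coxeter_relator [:: (x, true); (x, true)]
| cox_commute x y : x <> y -> ~ cg_edge D x y ->
    coxeter_relator (power_word x y 2)
| cox_braid x y (e : cg_edge D x y) n : cg_label e = Some n ->
    coxeter_relator (power_word x y (val n)).

Definition coxeter_group : groupType := presented coxeter_relator.

Definition cox_gen (x : V) : coxeter_group := pres_gen coxeter_relator x.

End CoxeterGroups.


(* Neither the group nor the type set has to be finite, and parabolic may     *)
(* fail to be injective.                                                      *)
Record coset_system (G : groupType) (I : Type) := CosetSystem {
  parabolic :> I -> set G;
  parabolic_subgroup : forall i, subgroup (parabolic i) }.

Definition lcosets (G : groupType) (H : set G) : set (set G) :=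
  [set S | exists g, S = [set g * h | h in H]].

Section LeftCosets.
Variables (G : groupType) (H : set G).

Fact base_coset_subproof : H \in lcosets H.
Proof.
apply/mem_set; exists 1; apply/seteqP; split=> [x Hx|_ [x Hx <-]].
  by exists x; rewrite ?mul1g.
by rewrite mul1g.
Qed.

Definition base_coset : lcosets H := exist _ H base_coset_subproof.

Fact coset_act_subproof (g : G) (F : lcosets H) :
  [set g * x | x in val F] \in lcosets H.
Proof.
have [k Fk] := set_mem (valP F); apply/mem_set; exists (g * k); rewrite Fk.
apply/seteqP; split=> [_ [_ [h Hh <-] <-]|_ [h Hh <-]].
  by exists h; rewrite ?mulgA.
by exists (k * h); [exists h|rewrite mulgA].
Qed.

Definition coset_act (g : G) (F : lcosets H) : lcosets H :=
  exist _ [set g * x | x in val F] (coset_act_subproof g F).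

Lemma coset_act_is_action : is_action coset_act.
Proof.
split=> [F|g h F]; apply: val_inj; apply/seteqP; split=> /=.
- by move=> _ [x Fx <-]; rewrite mul1g.
- by move=> x Fx; exists x; rewrite ?mul1g.
- by move=> _ [x Fx <-]; exists (h * x); [exists x|rewrite mulgA].
- by move=> _ [_ [x Fx <-] <-]; exists x; rewrite ?mulgA.
Qed.

End LeftCosets.

Section Incidence.
Variables (B : groupType) (I : Type) (beta : coset_system B I).

Definition parabolic_meet (J : set I) : set B := \bigcap_(i in J) beta i.

(* An element remembers its type: the same coset may occur for two types.     *)
Definition element : Type := {i : I & lcosets (beta i)}.

Definition incident (x y : element) : Prop :=
  val (tagged x) `&` val (tagged y) !=set0.

Definition element_act (b : B) (x : element) : element :=
  Tagged (fun i => lcosets (beta i)) (coset_act b (tagged x)).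

Definition flag (F : set element) : Prop :=
  forall x y, F x -> F y -> incident x y.

Definition flag_types (F : set element) : set I := [set tag x | x in F].

Definition flag_transitive : Prop :=
  forall (J : set I) (F F' : set element),
    flag F -> flag F' -> flag_types F = J -> flag_types F' = J ->
    exists b, [set element_act b x | x in F] = F'.

End Incidence.

Section Diagonals.
Variables (B : groupType) (I : Type) (beta : coset_system B I) (j : I).
Local Notation X := (lcosets (beta j)).

Definition diagonal (d : set X) : Prop :=
  exists F E : X, F <> E /\ d = [set F; E].

Definition diag_equiv (d d' : set X) : Prop :=
  exists b, [set coset_act b F | F in d] = d'.

Definition diag_class (d : set X) : set (set X) :=
  [set d' | diagonal d' /\ diag_equiv d d'].

Definition diag_classes : set (set (set X)) :=
  [set C | exists2 d, diagonal d & C = diag_class d].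

Fact class_of_subproof (F E : X) :
  F <> E -> diag_class [set F; E] \in diag_classes.
Proof. by move=> FE; apply/mem_set; exists [set F; E] => //; exists F, E. Qed.

(* The class [F, E]. *)
Definition class_of (F E : X) (FE : F <> E) : diag_classes :=
  exist _ (diag_class [set F; E]) (class_of_subproof FE).

Lemma class_of_sym (F E : X) (FE : F <> E) (EF : E <> F) :
  class_of FE = class_of EF.
Proof. by apply: val_inj => /=; rewrite setUC. Qed.

Lemma coset_act_inj b : injective (@coset_act B (beta j) b).
Proof.
move=> F E /(congr1 (coset_act b^-1)).
by rewrite -!(actM (coset_act_is_action _)) mulVg !(act1 (coset_act_is_action _)).
Qed.

Lemma class_of_act b (F E : X) (FE : F <> E)
    (bFE : coset_act b F <> coset_act b E) : class_of bFE = class_of FE.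
Proof.
have aM := actM (coset_act_is_action (beta j)).
have a1 := act1 (coset_act_is_action (beta j)).
have imM g h (d : set X) : [set coset_act g x | x in [set coset_act h y | y in d]]
    = [set coset_act (g * h) x | x in d].
  apply/seteqP; split=> [_ [_ [y dy <-] <-]|_ [y dy <-]].
    by exists y; rewrite ?aM.
  by exists (coset_act h y); [exists y|rewrite aM].
have E0 : [set coset_act b F; coset_act b E] =
    [set coset_act b x | x in [set F; E]].
  apply/seteqP; split=> [x [->|->]|_ [x [->|->] <-]].
  - by exists F => //; left.
  - by exists E => //; right.
  - by left.
  - by right.
apply: val_inj => /=; rewrite E0; apply/seteqP; split=> d [dd [c cd]].
  by split=> //; exists (c * b); rewrite -imM.
by split=> //; exists (c * b^-1); rewrite imM -mulgA mulVg mulg1.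
Qed.

Variable lambda : diag_classes -> label.

Definition is_two (l : label) : Prop := omap val l = Some 2%N.

Definition diag_edge (F E : X) : Prop :=
  exists FE : F <> E, ~ is_two (lambda (class_of FE)).

Fact diag_edge_neq F E : diag_edge F E -> F <> E.
Proof. by case. Qed.

Definition diag_label (F E : X) (e : diag_edge F E) : label :=
  lambda (class_of (diag_edge_neq e)).

Fact diag_edge_irr F : ~ diag_edge F F.
Proof. by case. Qed.

Fact diag_edge_sym F E : diag_edge F E -> diag_edge E F.
Proof.
move=> [FE h]; have EF : E <> F by move/esym.
by exists EF; rewrite (class_of_sym EF FE).
Qed.

Fact diag_label_sym F E (e : diag_edge F E) (e' : diag_edge E F) :
  diag_label e = diag_label e'.
Proof. by congr lambda; exact: class_of_sym. Qed.

Definition diagonal_graph : coxeter_graph X :=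
  CoxeterGraph diag_edge_irr diag_edge_sym diag_label_sym.

End Diagonals.

Arguments diag_classes {B I} beta j.

Section StandardSystem.
Variables (V : choiceType) (D : coxeter_graph V).

Definition standard_parabolic (x : V) : set (coxeter_group D) :=
  generated [set cox_gen D y | y in [set y | y <> x]].

Definition standard_system : coset_system (coxeter_group D) V :=
  @CosetSystem _ _ standard_parabolic (fun=> generated_subgroup _).

End StandardSystem.

Section DiagonalAction.
Variables (B : groupType) (I : Type) (beta : coset_system B I) (j : I).
Variable lambda : diag_classes beta j -> label.
Local Notation X := (lcosets (beta j)).
Local Notation D := (diagonal_graph lambda).
Local Notation A := (coxeter_group D).

Lemma diag_edge_act b (F E : X) :
  cg_edge D (coset_act b F) (coset_act b E) <-> cg_edge D F E.
Proof.
split=> -[h hl].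
  have FE : F <> E by move=> FE; case: (h); rewrite FE.
  by exists FE; rewrite -(class_of_act FE h).
have bFE : coset_act b F <> coset_act b E.
  by move=> eFE; exact/h/(coset_act_inj eFE).
by exists bFE; rewrite (class_of_act h bFE).
Qed.

Fact diag_relators b r : coxeter_relator D r ->
  word_eval (fun F => cox_gen D (coset_act b F)) r = 1.
Proof.
have evE s : word_eval (fun F => cox_gen D (coset_act b F)) s =
    word_eval (cox_gen D) [seq (coset_act b l.1, l.2) | l <- s].
  by elim: s => [//|[x e] s /= ->].
have pwE x y n : [seq (coset_act b l.1, l.2) | l <- power_word x y n] =
    power_word (coset_act b x) (coset_act b y) n.
  by elim: n => //= n ->.
move=> Rr; rewrite evE; apply: pres_gen_rel.
case: Rr => [x|x y xy nxy|x y e n en].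
- exact: cox_square.
- rewrite pwE; apply: cox_commute => [e|/diag_edge_act //].
  exact/xy/(coset_act_inj e).
- have e' : cg_edge D (coset_act b x) (coset_act b y) by exact/diag_edge_act.
  rewrite pwE; apply: (cox_braid (e := e')); rewrite -en.
  by congr lambda; exact: class_of_act.
Qed.

Definition diag_hom (b : B) : A -> A :=
  pres_lift (fun F => cox_gen D (coset_act b F)).

Lemma diag_homM b : {morph diag_hom b : x y / x * y}.
Proof. exact/pres_liftM/diag_relators. Qed.

Lemma diag_hom_gen b F : diag_hom b (cox_gen D F) = cox_gen D (coset_act b F).
Proof. exact/pres_lift_gen/diag_relators. Qed.

Lemma diag_hom_comp b c : diag_hom (b * c) =1 diag_hom b \o diag_hom c.
Proof.
apply: pres_hom_eq; first exact: diag_homM.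
  by move=> x y /=; rewrite !diag_homM.
move=> F /=; rewrite -/(cox_gen D F) !diag_hom_gen.
by rewrite (actM (coset_act_is_action _)).
Qed.

Lemma diag_hom1 : diag_hom 1 =1 id.
Proof.
apply: pres_hom_eq => //; first exact: diag_homM.
by move=> F; rewrite -/(cox_gen D F) diag_hom_gen (act1 (coset_act_is_action _)).
Qed.

Fact diag_hom_bij b : bijective (diag_hom b).
Proof.
exists (diag_hom b^-1) => x.
  by rewrite -[LHS]/((diag_hom _ \o diag_hom _) x) -diag_hom_comp mulVg diag_hom1.
by rewrite -[LHS]/((diag_hom _ \o diag_hom _) x) -diag_hom_comp mulgV diag_hom1.
Qed.

Definition diag_action (b : B) : autom A :=
  Autom (@diag_homM b) (diag_hom_bij b).

Fact diag_action_morph : {morph diag_action : b c / b * c}.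
Proof. by move=> b c; apply: autom_eq; exact: diag_hom_comp. Qed.

HB.instance Definition _ :=
  isMultiplicative.Build B (autom A) diag_action diag_action_morph.

Lemma diag_action_gen b F :
  diag_action b (cox_gen D F) = cox_gen D (coset_act b F).
Proof. exact: diag_hom_gen. Qed.

End DiagonalAction.

Section Admissibility.
Variables (A : groupType) (Ia : Type) (alpha : coset_system A Ia).
Variables (B : groupType) (Ib : Type) (beta : coset_system B Ib).
Variable eta : {multiplicative B -> autom A}.

Definition permutes_parabolics : Prop :=
  forall b, set_bij (range alpha) (range alpha) (fun S => eta b @` S).

Definition induces (act : B -> Ia -> Ia) : Prop :=
  is_action act /\ forall b i, eta b @` alpha i = alpha (act b i).

(* The type b.i with eta(b)(A_i) = A_{b.i}: it exists as soon as eta permutes *)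
(* the A_i, and is then unique when the A_i are pairwise distinct.            *)
Definition induced_act (b : B) (i : Ia) : Ia :=
  if pselect (exists k, eta b @` alpha i = alpha k) is left h
  then sval (cid h) else i.

Definition orbit_representatives (rep : set Ia -> Ia) : Prop :=
  forall L, orbits induced_act L -> L (rep L).

(* The set O_L(M), for i the representative of the orbit L.                   *)
Definition suborbit (i : Ia) (M : set Ib) : set Ia :=
  [set induced_act b i | b in parabolic_meet beta (~` M)].

Definition admissible (rep : set Ia -> Ia) : Prop :=
  permutes_parabolics /\
  forall L, orbits induced_act L -> forall M N : set Ib,
    suborbit (rep L) M `&` suborbit (rep L) N = suborbit (rep L) (M `&` N).

End Admissibility.

(* Main.v *)
Require Import Defs.
From mathcomp Require Import all_boot.
From mathcomp Require Import all_algebra all_field.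
From mathcomp Require Import ring.
From mathcomp Require Import boolp classical_sets functions cardinality.

Set Implicit Arguments.
Unset Strict Implicit.
Unset Printing Implicit Defensive.

Import GRing.Theory Num.Theory.

Local Open Scope classical_set_scope.

(** Everything rests on one fact about Coxeter groups: distinct generators
    have distinct parabolic subgroups ([standard_parabolic_inj]).  The
    automorphism [eta b] maps the generators of A_F to those of A_{bF}, hence
    A_F to A_{bF}; once the A_F are known to be pairwise distinct, the action
    induced on types can only be left multiplication of B on the cosets of
    B_j.  That action is transitive, so there is a single orbit, and
    admissibility is by definition the displayed condition on its base point.

    To separate the parabolic subgroups, the Coxeter group is made to act by
    the contragredient of its geometric representation, on all functions
    f : V -> K (with K the algebraic numbers).  The reflection of x sends f to
    f - f(x) c_x, where c_x x = 2 and c_x y = z + 1/z for z a primitive root of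
    unity of order twice the label of {x, y} (which counts as 2 without an
    edge; any value will do for an infinite label).  [reflection_braid] checks
    the relations.  The reflection of x fixes every f that vanishes at x.
    Hence the parabolic subgroup of x fixes the indicator function of x,
    whereas the generator x does not, and the latter lies in every other
    parabolic subgroup.

    Flag-transitivity gives the intersection property
    ([flag_transitive_base_orbit]) as follows.  Let F = b B_j = c B_j with b in
    B_H and c in B_K, where H, K are the complements of M, N.  If j is in H or
    K, then F is B_j and there is nothing to do.  Otherwise the standard cosets
    of the types in H or K form a flag, both together with B_j and together
    with F (b and c witness the incidences).  An element d carrying the first
    flag to the second fixes B_i for every i in H or K, hence lies in B_H and
    B_K, and it maps B_j to F. *)

(** * The contragredient geometric representation *)

Section Reflections.
Variables (K : fieldType) (V : Type) (c : V -> V -> K).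
Local Open Scope ring_scope.

Definition reflection (x : V) (f : V -> K) : V -> K :=
  fun y => f y - f x * c x y.

Lemma reflection_fix x f : f x = 0 -> reflection x f = f.
Proof. by move=> fx; apply/funext => y; rewrite /reflection fx mul0r subr0. Qed.

Hypothesis c_diag : forall x, c x x = 2.

Lemma reflectionK x : involutive (reflection x).
Proof. by move=> f; apply/funext => y; rewrite /reflection c_diag; ring. Qed.

(** The linear forms f x - z f y and f x - z^-1 f y are eigenvectors of the
    product of the two reflections, with eigenvalues z ^ 2 and z ^- 2, so its
    m-th power preserves f x and f y.  It also moves f by a combination of c_x
    and c_y, and such a combination vanishing at both x and y is zero because
    the Gram determinant 4 - (z + z^-1)^2 is not. *)
Lemma reflection_braid x y (z : K) m :
  z ^+ 2 != 1 -> z ^+ m.*2 = 1 -> c x y = z + z^-1 -> c y x = z + z^-1 ->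
  forall f, iter m (reflection x \o reflection y) f = f.
Proof.
case: m => [//|m]; set n := m.+1 => z2 zn cxy cyx f.
have z0 : z != 0.
  by apply: contra_eq_neq zn => ->; rewrite expr0n eq_sym oner_eq0.
pose T := reflection x \o reflection y.
rewrite -/T; pose u g := g x - z * g y; pose v g := g x - z^-1 * g y.
have Tu g : u (T g) = z ^+ 2 * u g.
  by rewrite /u /T /reflection /= !c_diag cxy cyx; field.
have Tv g : v (T g) = z ^- 2 * v g.
  by rewrite /v /T /reflection /= !c_diag cxy cyx; field.
have iter_eigen (l : (V -> K) -> K) a k :
    (forall g, l (T g) = a * l g) -> l (iter k T f) = a ^+ k * l f.
  move=> lT; elim: k => [|k IHk]; first by rewrite mul1r.
  by rewrite /= lT IHk exprS mulrA.
have [p [q Tpq]] : exists p q, forall w,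
    iter n T f w = f w - p * c x w - q * c y w.
  elim: (n) => [|k [p [q IHk]]] /=; first by exists 0, 0 => w; ring.
  set g := iter k T f in IHk *; exists (p + reflection y g x), (q + g y) => w.
  by rewrite /T /= {1}/reflection {1}/reflection IHk; ring.
have z2n : (z ^+ 2) ^+ n = 1 by rewrite -exprM mul2n.
have zNz : z - z^-1 != 0.
  by apply: contra_neq z2 => /subr0_eq zV; rewrite expr2 {1}zV mulVf.
have eu : u (iter n T f) = u f by rewrite (iter_eigen _ _ _ Tu) z2n mul1r.
have ev : v (iter n T f) = v f.
  by rewrite (iter_eigen _ _ _ Tv) exprVn z2n invr1 mul1r.
rewrite {1}/u !Tpq !c_diag cxy cyx in eu.
rewrite {1}/v !Tpq !c_diag cxy cyx in ev.
have Q0 : (z + z^-1) * p + 2 * q = 0.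
  have d := subrr (u f); rewrite -{1}eu in d.
  have d' := subrr (v f); rewrite -{1}ev in d'.
  (* Of eu and ev the difference is (z - z^-1) ((z + z^-1) p + 2 q) = 0. *)
  apply: (mulfI zNz); rewrite mulr0 -[RHS](subrr 0) -{1}d -d' /u /v; ring.
have P0 : 2 * p + (z + z^-1) * q = 0.
  transitivity (z * ((z + z^-1) * p + 2 * q)); last by rewrite Q0 mulr0.
  have d := subrr (u f); rewrite -{1}eu in d.
  by apply/eqP; rewrite -subr_eq0 -oppr_eq0 -d /u; apply/eqP; ring.
have gram : - (z - z^-1) ^+ 2 != 0 by rewrite oppr_eq0 expf_neq0.
have gramE : - (z - z^-1) ^+ 2 = 4 - (z + z^-1) ^+ 2 by field.
have p0 : p = 0.
  apply: (mulfI gram); rewrite mulr0 gramE.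
  transitivity (2 * (2 * p + (z + z^-1) * q) -
    (z + z^-1) * ((z + z^-1) * p + 2 * q)); first by ring.
  by rewrite P0 Q0; ring.
have q0 : q = 0.
  apply: (mulfI gram); rewrite mulr0 gramE.
  transitivity (2 * ((z + z^-1) * p + 2 * q) -
    (z + z^-1) * (2 * p + (z + z^-1) * q)); first by ring.
  by rewrite P0 Q0; ring.
by apply/funext => w; rewrite Tpq p0 q0; ring.
Qed.

End Reflections.

(** * Distinct generators have distinct parabolic subgroups *)

Section WordAction.
Variables (V : choiceType) (T : Type) (s : V -> T -> T).

(** Both letters of a generator act alike, since generators act by
    involutions. *)
Definition word_act (w : seq (V * bool)) (t : T) : T :=
  foldr (fun l => s l.1) t w.

Lemma word_act_cat u v t : word_act (u ++ v) t = word_act u (word_act v t).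
Proof. by rewrite /word_act foldr_cat. Qed.

Hypothesis sK : forall x, involutive (s x).

Lemma word_act_pres_eq (R : set (seq (V * bool))) u v :
  (forall r, R r -> word_act r =1 id) ->
  pres_eq R u v -> word_act u =1 word_act v.
Proof.
move=> Rid; elim=> {u v} [//|u v _ h t|u v w _ h _ h' t|u x e v t|u r v Rr t].
- by rewrite h.
- by rewrite h h'.
- by rewrite !word_act_cat /= sK.
- by rewrite !word_act_cat (Rid _ Rr).
Qed.

Lemma word_act_inv w t : word_act w t = t -> word_act (inv_word w) t = t.
Proof.
move=> wt; rewrite -{1}wt; elim: w t {wt} => [//|[x e] w IHw] t.
by rewrite /inv_word /= rev_cons -cats1 word_act_cat /= sK IHw.
Qed.

End WordAction.

Section ParabolicInjectivity.
Variables (V : choiceType) (D : coxeter_graph V).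
Local Open Scope ring_scope.

(** With z of order 2m, z + z^-1 is a Galois conjugate of 2 cos(pi / m), up to
    the sign convention the off-diagonal entry of the geometric representation;
    it is 0 for m = 2, so commuting generators need no separate case. *)
Definition primitive_root2 (m : nat) : algC :=
  if m is k.+1 then sval (C_prim_root_exists (n := k.+1.*2) isT) else 1.

Lemma primitive_root2_neq1 m : (2 <= m)%N -> primitive_root2 m ^+ 2 != 1.
Proof.
case: m => [//|m] m1; rewrite /primitive_root2.
case: C_prim_root_exists => z /= zP.
rewrite -(prim_order_dvd zP); apply/negP => /dvdn_leq.
by rewrite doubleS !ltnS leqn0 double_eq0 => /(_ isT)/eqP m0; rewrite m0 in m1.
Qed.

Lemma primitive_root2_exp m : (0 < m)%N -> primitive_root2 m ^+ m.*2 = 1.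
Proof.
case: m => [//|m] _; rewrite /primitive_root2.
case: C_prim_root_exists => z /= zP.
exact: prim_expr_order.
Qed.

(** Edges labelled oo impose no relation, so that any value serves for them. *)
Definition coxeter_order (x y : V) : nat :=
  if pselect (cg_edge D x y) is left e then
    if cg_label e is Some n then val n else 2%N
  else 2%N.

Lemma coxeter_orderC x y : coxeter_order x y = coxeter_order y x.
Proof.
rewrite /coxeter_order.
case: pselect => [e|ne]; case: pselect => [e'|ne'] //.
- by rewrite (cg_label_sym e e').
- by have := cg_sym e.
- by have := cg_sym e'.
Qed.

Lemma coxeter_order_gt1 x y : (2 <= coxeter_order x y)%N.
Proof.
rewrite /coxeter_order; case: pselect => // e.
by case: cg_label => [[n n2]|].
Qed.

Definition coxeter_coef (x y : V) : algC :=
  let z := primitive_root2 (coxeter_order x y) in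
  if x == y then 2 else z + z^-1.

Lemma coxeter_coef_diag x : coxeter_coef x x = 2.
Proof. by rewrite /coxeter_coef eqxx. Qed.

Local Notation s := (reflection coxeter_coef).

Lemma power_word_act x y n f :
  word_act s (power_word x y n) f = iter n (s x \o s y) f.
Proof. by elim: n => //= n <-. Qed.

Lemma braid_act x y f :
  x <> y -> word_act s (power_word x y (coxeter_order x y)) f = f.
Proof.
move=> /eqP xy; rewrite power_word_act; have m2 := coxeter_order_gt1 x y.
apply: (reflection_braid coxeter_coef_diag (primitive_root2_neq1 m2)).
- exact/primitive_root2_exp/ltnW.
- by rewrite /coxeter_coef (negbTE xy).
- by rewrite /coxeter_coef eq_sym (negbTE xy) coxeter_orderC.
Qed.

Lemma relator_act r : coxeter_relator D r -> word_act s r =1 id.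
Proof.
have sK := reflectionK coxeter_coef_diag.
case=> {r} [x|x y xy ne|x y e n en] f; first exact: sK.
- rewrite -[RHS](braid_act f xy) /coxeter_order.
  by case: pselect.
- have xy : x <> y by move=> xy; subst y; exact: cg_irr e.
  rewrite -[RHS](braid_act f xy) /coxeter_order.
  case: pselect => // e'.
  by rewrite (Prop_irrelevance e' e) en.
Qed.

Local Notation parabolic := (@standard_parabolic V D).

Definition indicator (x y : V) : algC := (y == x)%:R.

(** Each generator y other than x fixes the indicator function of x, which
    vanishes at y, so the stabiliser contains the parabolic subgroup of x.  It
    is phrased with words because the group acts only through them. *)
Lemma parabolic_stabilizes x w :
  parabolic x (pres_class _ w) ->
  word_act s w (indicator x) = indicator x.
Proof.
have sK := reflectionK coxeter_coef_diag.
have actE u v : pres_class (coxeter_relator D) u = pres_class _ v ->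
    word_act s u =1 word_act s v.
  by move=> /pres_classP; apply: word_act_pres_eq => //; exact: relator_act.
pose H : set (coxeter_group D) := [set a | forall u, pres_class _ u = a ->
  word_act s u (indicator x) = indicator x].
move=> xw; apply: (xw H) => //; split=> [|_ [y yx <-] u uy].
  split=> [u u1|a b|a]; first by rewrite (actE _ _ u1).
  - elim/pres_ind: a => u; elim/pres_ind: b => v Hu Hv w'.
    rewrite [(_ * _)%g]pres_mulE => /actE w'E.
    by rewrite w'E word_act_cat Hv // Hu.
  - elim/pres_ind: a => u Hu w'.
    rewrite [(_^-1)%g]pres_invE => /actE w'E.
    by rewrite w'E; apply: word_act_inv => //; exact: Hu.
rewrite (actE _ _ uy) /=.
by apply: reflection_fix; rewrite /indicator; case: eqP.
Qed.

(** The generator x lies in every parabolic subgroup but its own, because it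
    negates the value at x of the indicator function of x. *)
Lemma standard_parabolic_inj : injective parabolic.
Proof.
move=> x y eq_xy; apply: contrapT => xy.
have: parabolic x (cox_gen D x).
  by rewrite eq_xy => H [_ HV]; apply: HV; exists x.
move=> /parabolic_stabilizes /(congr1 (fun f => f x)) /= /eqP.
rewrite /reflection /indicator eqxx coxeter_coef_diag mul1r /=.
by rewrite -subr_eq0 addrAC subrr sub0r oppr_eq0 pnatr_eq0.
Qed.

End ParabolicInjectivity.

(** * The action on types *)

Section TypeAction.
Variables (B : groupType) (I : Type) (beta : coset_system B I) (j : I).
Variable lambda : diag_classes beta j -> label.
Local Notation X := (lcosets (beta j)).
Local Notation D := (diagonal_graph lambda).
Local Notation alpha := (standard_system D).
Local Notation eta := (diag_action lambda).
Local Open Scope group_scope.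

Local Notation parabolic := (@standard_parabolic X D).

Let aM := actM (coset_act_is_action (beta j)).
Let a1 := act1 (coset_act_is_action (beta j)).

Lemma coset_act_transitive : transitive_action (@coset_act B (beta j)).
Proof.
move=> F E; have [g Fg] := set_mem (valP F); have [h Eh] := set_mem (valP E).
exists (h * g^-1); apply: val_inj => /=; rewrite Fg Eh; apply/seteqP; split.
  by move=> _ [_ [x Hx <-] <-]; exists x => //; rewrite mulgA mulgVK.
move=> _ [x Hx <-]; exists (g * x); first by exists x.
by rewrite mulgA mulgVK.
Qed.

Lemma diag_actionK b : cancel (eta b) (eta b^-1).
Proof.
move=> a; rewrite -[LHS]/((diag_hom (b^-1) \o diag_hom b) a) -diag_hom_comp.
by rewrite mulVg diag_hom1.
Qed.

Lemma diag_action_sub b F :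
  eta b @` parabolic F `<=` parabolic (coset_act b F).
Proof.
move=> _ [a Fa <-]; apply: (Fa [set a | parabolic _ (eta b a)]).
have [H1 HM HV] := parabolic_subgroup alpha (coset_act b F).
split=> [|_ [E EF <-] /=].
  have hb1 : diag_hom (lambda := lambda) b 1 = 1.
    by apply: (mulgI (diag_hom b 1)); rewrite -diag_homM !mulg1.
  split=> [|x y Hx Hy|x Hx] /=; first by rewrite hb1.
    by rewrite diag_homM; exact: HM.
  suff -> : diag_hom b x^-1 = (diag_hom b x)^-1 by exact: HV.
  by apply: (mulgI (diag_hom b x)); rewrite -diag_homM !mulgV hb1.
rewrite diag_hom_gen => H [_]; apply; exists (coset_act b E) => //.
by move=> eEF; apply: EF; exact: coset_act_inj eEF.
Qed.

Lemma diag_action_parabolic b F :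
  eta b @` alpha F = alpha (coset_act b F).
Proof.
apply/seteqP; split; first exact: diag_action_sub.
move=> a Fa; exists (eta b^-1 a).
  have := @diag_action_sub b^-1 (coset_act b F) _ (ex_intro2 _ _ a Fa erefl).
  by rewrite -aM mulVg a1.
by rewrite -{1}[b]invgK diag_actionK.
Qed.

(** The type k with eta b (A_F) = A_k is determined because the A_F are pairwise
    distinct. *)
Lemma diag_induced_act : induced_act alpha eta = @coset_act B (beta j).
Proof.
apply/funext => b; apply/funext => F; rewrite /induced_act.
case: pselect => [h|[]]; last first.
  by exists (coset_act b F); exact: diag_action_parabolic.
case: cid => k /= kF; apply: (@standard_parabolic_inj _ D).
by rewrite -[RHS]diag_action_parabolic -[LHS]kF.
Qed.

Lemma diag_permutes : permutes_parabolics alpha eta.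
Proof.
move=> b; split=> [_ [F _ <-]|S S' _ _ eS|_ [F _ <-]].
- by exists (coset_act b F) => //; rewrite -diag_action_parabolic.
- have imK U : eta b^-1 @` (eta b @` U) = U.
    by rewrite image_comp (funext (diag_actionK b : _ \o _ =1 id)) image_id.
  by rewrite -[S]imK eS imK.
- exists (alpha (coset_act b^-1 F)); first by exists (coset_act b^-1 F).
  by rewrite diag_action_parabolic -aM mulgV a1.
Qed.

Lemma diag_orbits : orbits (@coset_act B (beta j)) = [set [set: X]].
Proof.
have orbT F : [set coset_act g F | g in setT] = [set: X].
  apply/seteqP; split=> // E _.
  by have [g gF] := coset_act_transitive F E; exists g.
apply/seteqP; split=> [_ [F ->] /=|_ ->]; first exact: orbT.
by exists (base_coset (beta j)); rewrite orbT.
Qed.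

End TypeAction.

(** * Flag-transitivity *)

Section FlagTransitivity.
Variables (B : groupType) (I : Type) (beta : coset_system B I) (j : I).
Local Open Scope group_scope.

Let b0 := base_coset (beta j).

(** The set O(M), with the action on types already identified as left
    multiplication. *)
Definition base_orbit (M : set I) : set (lcosets (beta j)) :=
  [set coset_act b b0 | b in parabolic_meet beta (~` M)].

Lemma parabolic_coset b i :
  [set b * x | x in beta i] = beta i :> set B -> beta i b.
Proof.
have [H1 _ _] := parabolic_subgroup beta i.
by move=> <-; exists 1; rewrite ?mulg1.
Qed.

Lemma coset_parabolic b i :
  beta i b -> [set b * x | x in beta i] = beta i :> set B.
Proof.
have [_ HM HV] := parabolic_subgroup beta i => bi.
apply/seteqP; split=> [_ [x Hx <-]|x Hx]; first exact: HM.
by exists (b^-1 * x); [apply: HM => //; exact: HV|rewrite mulVKg].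
Qed.

Definition base_element (i : I) : element beta :=
  Tagged (fun i => lcosets (beta i)) (base_coset (beta i)).

(** Flag-transitivity turns the two witnesses b and c for a coset
    F = b B_j = c B_j into a single one: the element that carries the flag of
    B_j and the standard cosets B_i, for i outside M or outside N, to the flag
    of F and the same B_i. *)
Lemma flag_transitive_base_orbit : flag_transitive beta ->
  forall M N, base_orbit M `&` base_orbit N = base_orbit (M `&` N).
Proof.
move=> ft M N; apply/seteqP; split; last first.
  by move=> F [b bMN <-]; split; exists b => // i Mi; apply: bMN => -[].
move=> F [[b bM bF] [c cN cF]].
pose J := ~` M `|` ~` N.
have baseF : F = b0 -> base_orbit (M `&` N) F.
  move=> ->; exists 1; last exact: act1 (coset_act_is_action _) _.
  by move=> i _; have [] := parabolic_subgroup beta i.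
(* If j is in J, the cosets B_i and F would give two elements of type j, but
   in that case b or c lies in B_j and F is B_j itself. *)
have [Jj|nJj] := pselect (J j).
  apply: baseF; apply: val_inj; case: Jj => jMN.
    by rewrite -bF; apply: coset_parabolic; exact: bM.
  by rewrite -cF; apply: coset_parabolic; exact: cN.
pose el (G : lcosets (beta j)) : element beta :=
  Tagged (fun i => lcosets (beta i)) G.
pose fl (x : element beta) := [set x] `|` [set base_element i | i in J].
have one i : beta i 1 by have [] := parabolic_subgroup beta i.
have fl_flag G : (forall i, J i -> (val G : set B) `&` beta i !=set0) ->
    val G !=set0 -> flag (fl (el G)).
  move=> GJ G0 x y [->|[i Ji <-]] [->|[k Jk <-]]; rewrite /incident /=.
  - by rewrite setIid.
  - exact: GJ.
  - by rewrite setIC; exact: GJ.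
  - by exists 1; split; exact: one.
have fl_types G : flag_types (fl (el G)) = j |` J.
  apply/seteqP; split=> [_ [x [->|[i Ji <-]] <-]|i [->|Ji]].
  - by left.
  - by right.
  - by exists (el G) => //; left.
  - by exists (base_element i) => //; right; exists i.
have bFb : val F b by rewrite -bF; exists 1; rewrite ?mulg1 //; exact: one.
have cFc : val F c by rewrite -cF; exists 1; rewrite ?mulg1 //; exact: one.
have [] := ft (j |` J) (fl (el b0)) (fl (el F)).
- by apply: fl_flag => [i _|]; exists 1; [split|]; exact: one.
- apply: fl_flag => [i [Mi|Ni]|]; last by exists b.
  + by exists b; split=> //; exact: bM.
  + by exists c; split=> //; exact: cN.
- exact: fl_types.
- exact: fl_types.
move=> d dfl.
have dJ i : J i -> beta i d.
  move=> Ji; have : fl (el F) (element_act d (base_element i)).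
    by rewrite -dfl; exists (base_element i) => //; right; exists i.
  move=> [/(congr1 tag) /= ij|[k Jk ek]]; first by case: nJj; rewrite -ij.
  have ki : k = i by have := congr1 tag ek.
  subst k; apply: parabolic_coset.
  by have := congr1 (fun x : element beta => val (tagged x) : set B) ek.
exists d; first by move=> i /not_andP [Mi|Ni]; apply: dJ; [left|right].
have : fl (el F) (element_act d (base_element j)).
  by rewrite -dfl; exists (base_element j) => //; left.
move=> [eF|[k Jk ek]].
  apply: val_inj.
  by have := congr1 (fun x : element beta => val (tagged x) : set B) eF.
by case: nJj; have <- : k = j by have := congr1 tag ek.
Qed.

End FlagTransitivity.

(** * Admissibility of the standard coset incidence system *)

Theorem theorem3p5 (B : groupType) (I : Type) (beta : coset_system B I) (j : I)
  (lambda : diag_classes beta j -> label)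
  (Xfin : finite_set (lcosets (beta j)))
  (Xgt1 : exists F E : lcosets (beta j), F <> E) :
  let X := lcosets (beta j) in
  let D := diagonal_graph lambda in
  let A := coxeter_group D in
  let alpha : coset_system A X := standard_system D in
  let eta : {multiplicative B -> autom A} := diag_action lambda in
  let b0 : X := base_coset (beta j) in
  let orb : set I -> set X := suborbit alpha beta eta b0 in
  [/\ permutes_parabolics alpha eta,
      unique (induces alpha eta) (induced_act alpha eta),
      transitive_action (induced_act alpha eta),
      orbits (induced_act alpha eta) = [set [set: X]] &
      forall rep : set X -> X,
        orbit_representatives alpha eta rep -> rep [set: X] = b0 ->
        (admissible alpha beta eta rep <->
           forall M N : set I, orb M `&` orb N = orb (M `&` N)) /\
        (flag_transitive beta -> admissible alpha beta eta rep)].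
Proof.
move=> X D A alpha eta b0 orb.
have actE : induced_act alpha eta = @coset_act B (beta j).
  exact: diag_induced_act.
have orbE : orb = base_orbit (beta := beta) (j := j).
  by apply/funext => M; rewrite /orb /suborbit actE.
have orbitsE : orbits (induced_act alpha eta) = [set [set: X]].
  by rewrite actE; exact: diag_orbits.
split=> //; first exact: diag_permutes.
- split=> [|act [_ act_eta]]; rewrite actE.
    split; first exact: coset_act_is_action.
    exact: diag_action_parabolic.
  apply/funext => b; apply/funext => F; apply: (@standard_parabolic_inj _ D).
  by rewrite -[LHS]diag_action_parabolic; exact: act_eta.
- by rewrite actE; exact: coset_act_transitive.
move=> rep _ repT.
have adm : admissible alpha beta eta rep <->
    forall M N : set I, orb M `&` orb N = orb (M `&` N).
  rewrite /admissible orbitsE; split=> [[_ h] M N|h].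
    by have := h _ erefl M N; rewrite repT.
  by split=> [|_ -> M N]; [exact: diag_permutes|rewrite repT; exact: h].
split=> // ft; apply/adm; rewrite orbE; exact: flag_transitive_base_orbit.
Qed.
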